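(* Let $\mathcal{X}\subseteq\mathbb{R}^n$, $\mathcal{U}\subseteq\mathbb{R}^p$, $N_x\ge n$, let $g_{n+1},\dots,g_{N_x}:\mathcal{X}\to\mathbb{R}$ be functions, and let $\mathbf{A}\in\mathbb{R}^{N_x\times N_x}$, $\mathbf{B}\in\mathbb{R}^{N_x\times p}$. Suppose that $\chi_0\in\mathcal{X}$, $u_0\in\mathcal{U}$ and $\hat\chi_0\in\mathcal{X}$ satisfy $$\mathbf{A}\begin{bmatrix}\chi_0\\ g_{n+1}(\chi_0)\\ \vdots\\ g_{N_x}(\chi_0)\end{bmatrix}+\mathbf{B}u_0=\begin{bmatrix}\hat\chi_0\\ g_{n+1}(\hat\chi_0)\\ \vdots\\ g_{N_x}(\hat\chi_0)\end{bmatrix}.$$ Then the following two conditions are equivalent: (i) For any $u\in\mathcal{U}$, $$\mathbf{A}\begin{bmatrix}\chi_0\\ g_{n+1}(\chi_0)\\ \vdots\\ g_{N_x}(\chi_0)\end{bmatrix}+\mathbf{B}u\in\mathcal{M}.$$ (ii) For any $u\in\mathcal{U}$, there exists $\chi\in\mathcal{X}$ such that $$\mathbf{B}\,\Delta u=\begin{bmatrix}\chi-\hat\chi_0\\ g_{n+1}(\chi)-g_{n+1}(\hat\chi_0)\\ \vdots\\ g_{N_x}(\chi)-g_{N_x}(\hat\chi_0)\end{bmatrix},\qquad \Delta u:=u-u_0.$$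
   Context: The set $\mathcal{M}$ is the set on which the embedded state is defined: $$\mathcal{M}:=\left\{v=[v_1\ \cdots\ v_{N_x}]^{\mathsf T}\in\mathbb{R}^{N_x}\ \middle|\ \exists\,\chi\in\mathcal{X}:\ [v_1\ \cdots\ v_n]^{\mathsf T}=\chi,\ v_i=g_i(\chi)\ (i=n+1,\dots,N_x)\right\}.$$ The data $(g_i,\mathbf{A},\mathbf{B})$ define a linear embedding model that approximates the embedded successor state of a discrete-time system by $\mathbf{A}[\chi^{\mathsf T}\ g_{n+1}(\chi)\ \cdots\ g_{N_x}(\chi)]^{\mathsf T}+\mathbf{B}u$ for state $\chi\in\mathcal{X}$ and input $u\in\mathcal{U}$. *)

(* Defs.v *)
(* MathComp-Analysis, over an arbitrary model [R : realType] of the reals *)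
From mathcomp Require Import all_boot all_order all_algebra.
From mathcomp Require Import boolp classical_sets reals.
Set Implicit Arguments.
Unset Strict Implicit.
Unset Printing Implicit Defensive.
Import Order.TTheory GRing.Theory Num.Theory.
Local Open Scope classical_set_scope.
Local Open Scope ring_scope.

(* A vector of dimension [Nx >= n] is split into [n] leading and [Nx - n]
   trailing coordinates.  The families indexed by n+1, .., Nx are indexed here
   by ['I_(Nx - n)], the 0-based position [j] standing for the index n+1+j. *)

Definition head_ord (n Nx : nat) (hn : (n <= Nx)%N) (i : 'I_n) : 'I_Nx :=
  widen_ord hn i.

Definition tail_ord (n Nx : nat) (hn : (n <= Nx)%N) (j : 'I_(Nx - n)) : 'I_Nx :=
  cast_ord (subnKC hn) (rshift n j).

Definition stack (R : realType) (n Nx : nat) (hn : (n <= Nx)%N)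
    (a : 'cV[R]_n) (b : 'cV[R]_(Nx - n)) : 'cV[R]_Nx :=
  castmx (subnKC hn, erefl 1%N) (col_mx a b).

(* [X] is used both as a set and, through the coercion [set_type], as the type
   of its points: the functions [g j] are defined on [X] only. *)

Definition embed (R : realType) (n Nx : nat) (hn : (n <= Nx)%N)
    (X : set 'cV[R]_n) (g : 'I_(Nx - n) -> X -> R) (chi : X) : 'cV[R]_Nx :=
  stack hn (\val chi) (\col_j g j chi).

Definition embedded_states (R : realType) (n Nx : nat) (hn : (n <= Nx)%N)
    (X : set 'cV[R]_n) (g : 'I_(Nx - n) -> X -> R) : set 'cV[R]_Nx :=
  [set v | exists chi : X,
     \col_(i < n) v (head_ord hn i) 0 = \val chi /\
     forall j : 'I_(Nx - n), v (tail_ord hn j) 0 = g j chi].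

(* Main.v *)
Require Import Defs.
From mathcomp Require Import all_boot all_order all_algebra.
From mathcomp Require Import boolp classical_sets reals.
Set Implicit Arguments.
Unset Strict Implicit.
Unset Printing Implicit Defensive.
Import Order.TTheory GRing.Theory Num.Theory.
Local Open Scope classical_set_scope.
Local Open Scope ring_scope.

(** Membership in the set of embedded states only says that a vector is the
    embedding of some point of [X] ([embedded_statesP]).  By the hypothesis on
    [chi0], [u0] and [chihat0], the successor of [chi0] under [u] is
    [embed chihat0 + B *m (u - u0)], so it equals [embed chi] exactly when
    [B *m (u - u0) = embed chi - embed chihat0].  Stacking is additive, hence
    this difference is the vector of differences in the second condition
    ([embedB]).  The two conditions therefore agree input by input, with the
    same witness [chi]. *)

Lemma stack_head (R : realType) (n Nx : nat) (hn : (n <= Nx)%N)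
    (a : 'cV[R]_n) (b : 'cV[R]_(Nx - n)) (i : 'I_n) :
  stack hn a b (head_ord hn i) 0 = a i 0.
Proof.
rewrite /stack castmxE /= cast_ord_id -[RHS](col_mxEu a b).
by congr (col_mx a b _ _); apply: val_inj.
Qed.

Lemma stack_tail (R : realType) (n Nx : nat) (hn : (n <= Nx)%N)
    (a : 'cV[R]_n) (b : 'cV[R]_(Nx - n)) (j : 'I_(Nx - n)) :
  stack hn a b (tail_ord hn j) 0 = b j 0.
Proof.
by rewrite /stack /tail_ord castmxE /= cast_ord_id cast_ordK col_mxEd.
Qed.

(** Since [n <= Nx], every index below [Nx] is leading or trailing, so a vector
    is determined by its two families of coordinates. *)
Lemma eq_head_tail (R : realType) (n Nx : nat) (hn : (n <= Nx)%N)
    (v w : 'cV[R]_Nx) :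
  (forall i : 'I_n, v (head_ord hn i) 0 = w (head_ord hn i) 0) ->
  (forall j : 'I_(Nx - n), v (tail_ord hn j) 0 = w (tail_ord hn j) 0) ->
  v = w.
Proof.
move=> vw_head vw_tail; apply/colP => k.
rewrite -(cast_ordKV (subnKC hn) k).
case: (split_ordP (cast_ord (esym (subnKC hn)) k)) => [i|j] ->.
- by have -> : cast_ord (subnKC hn) (lshift (Nx - n) i) = head_ord hn i
    by exact: val_inj.
- exact: vw_tail.
Qed.

Lemma embedded_statesP (R : realType) (n Nx : nat) (hn : (n <= Nx)%N)
    (X : set 'cV[R]_n) (g : 'I_(Nx - n) -> X -> R) (v : 'cV[R]_Nx) :
  embedded_states hn g v <-> exists chi : X, v = embed hn g chi.
Proof.
split=> [[chi [v_head v_tail]]|[chi ->]]; exists chi.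
- apply: (@eq_head_tail _ _ _ hn) => [i|j].
  + by rewrite stack_head -v_head mxE.
  + by rewrite stack_tail v_tail mxE.
- split=> [|j]; last by rewrite stack_tail mxE.
  by apply/colP => i; rewrite mxE stack_head.
Qed.

Lemma embedB (R : realType) (n Nx : nat) (hn : (n <= Nx)%N)
    (X : set 'cV[R]_n) (g : 'I_(Nx - n) -> X -> R) (chi chi' : X) :
  embed hn g chi - embed hn g chi' =
  stack hn (\val chi - \val chi') (\col_j (g j chi - g j chi')).
Proof.
apply: (@eq_head_tail _ _ _ hn) => [i|j].
- by rewrite stack_head !mxE !stack_head.
- by rewrite stack_tail !mxE !stack_tail !mxE.
Qed.

Theorem proposition3 (R : realType) (n p Nx : nat) (hn : (n <= Nx)%N)
    (X : set 'cV[R]_n) (U : set 'cV[R]_p)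
    (g : 'I_(Nx - n) -> X -> R)
    (A : 'M[R]_Nx) (B : 'M[R]_(Nx, p))
    (chi0 : X) (u0 : 'cV[R]_p) (hu0 : U u0) (chihat0 : X)
    (h0 : A *m embed hn g chi0 + B *m u0 = embed hn g chihat0) :
  (forall u : 'cV[R]_p, U u ->
     embedded_states hn g (A *m embed hn g chi0 + B *m u))
  <->
  (forall u : 'cV[R]_p, U u ->
     exists chi : X,
       B *m (u - u0) =
       stack hn (\val chi - \val chihat0)
                (\col_j (g j chi - g j chihat0))).
Proof.
have succE u : A *m embed hn g chi0 + B *m u =
    embed hn g chihat0 + B *m (u - u0).
  by rewrite -h0 mulmxBr -addrA [B *m u0 + _]addrC subrK.
split=> H u Uu.
- have /embedded_statesP[chi] := H u Uu.
  rewrite succE => chiE; exists chi.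
  by rewrite -embedB -chiE [RHS]addrC addKr.
- have [chi BE] := H u Uu; apply/embedded_statesP; exists chi.
  by rewrite succE BE -embedB addrC subrK.
Qed.
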